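(* Let $M\ge 2$ and $N$ be positive integers, and let $C_0,\dots,C_{N-1}$ be i.i.d. random variables, each uniformly distributed on $\{0,1,\dots,M-1\}$. Define the random matrix $\bm\Psi=[\bm\Psi_0,\bm\Psi_1,\dots,\bm\Psi_{N-1}]\in\mathbb{C}^{N\times MN}$, where $\bm\Psi_q=[\bm\psi_{0,q},\dots,\bm\psi_{M-1,q}]\in\mathbb{C}^{N\times M}$ and the $n$-th entry ($n=0,\dots,N-1$) of the column $\bm\psi_{p,q}$ is $[\bm\psi_{p,q}]_n=\frac{1}{\sqrt N}e^{j\frac{2\pi p}{M}C_n+j\frac{2\pi q}{N}n}$. Define the intra-block coherence $\mu_I=\max_{q}\|\bm\Psi_q^H\bm\Psi_q-\bm I_M\|_s$ and the inter-block coherence $\mu_B=\max_{q_1\neq q_2}\|\bm\Psi_{q_1}^H\bm\Psi_{q_2}\|_s$ (maxima over $q,q_1,q_2\in\{0,\dots,N-1\}$), where $\|\cdot\|_s$ is the spectral norm. Then for any constant $\epsilon>0$ and sufficiently large $N$, the inequality $$17\sqrt{\frac{K\log(MN)(1+\mu_I)}{N}}\,\|\bm\Psi\|_s+48\mu_B\log(MN)+\frac{2K}{N}\|\bm\Psi\|_s^2+3\mu_I\le\frac14$$ holds with probability at least $1-\epsilon$ (with respect to the random choice of $C_0,\dots,C_{N-1}$) whenever the positive integer $K$ satisfies $$K\le\frac{N\left(\frac18-\delta_1-\delta_2\right)^2}{81\,M\log(MN)\,(1+2\delta_2/3)},$$ where $\delta_1:=24\sqrt{\frac{M-1}{N}}\log(MN)\left(2\sqrt{\log(MN)-\log\epsilon}+1\right)$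 and $\delta_2:=\frac32\sqrt{\frac{M-1}{N}}\left(2\sqrt{\log(2M)-\log\epsilon}+1\right)$.
   Context: $j$ denotes the imaginary unit, $\log$ is the natural logarithm, $(\cdot)^H$ is conjugate transpose, $\bm I_M$ is the $M\times M$ identity, and $\|\bm A\|_s$ is the largest singular value of $\bm A$. The model is that of a randomized stepped frequency radar with $N$ pulses and $M$ carrier frequencies, under the simplification that Doppler-shift differences across carrier frequencies are neglected (so the entries of $\bm\psi_{p,q}$ are exactly as given). *)

(* Defs.v *)
From HB Require Import structures.
From mathcomp Require Import all_boot all_order all_algebra.
From mathcomp Require Import all_classical all_reals.
From mathcomp Require Import exp trigo.
From mathcomp Require Import complex.
Set Implicit Arguments. Unset Strict Implicit. Unset Printing Implicit Defensive.
Import Order.TTheory GRing.Theory Num.Theory.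
Local Open Scope ring_scope.
Local Open Scope classical_set_scope.

Section Defs.
Variable R : realType.

Definition vnorm n (x : 'cV[R[i]]_n) : R :=
  Num.sqrt (\sum_(i < n) (Normc.normc (x i 0)) ^+ 2).

Definition specnorm m n (A : 'M[R[i]]_(m, n)) : R :=
  sup [set r : R | exists x : 'cV[R[i]]_n, vnorm x = 1 /\ r = vnorm (A *m x)].

Definition ctrmx m n (A : 'M[R[i]]_(m, n)) : 'M[R[i]]_(n, m) :=
  map_mx (@conjc R) A^T.

Definition expi (t : R) : R[i] := (cos t +i* sin t)%C.

Definition psi_entry (M N : nat) (c : {ffun 'I_N -> 'I_M}) (p q : nat) (n : 'I_N)
  : R[i] :=
  ((Num.sqrt (N%:R : R))^-1 +i* 0)%C *
  expi (2 * pi * p%:R / M%:R * (c n)%:R + 2 * pi * q%:R / N%:R * n%:R).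

Definition Psi_blk (M N : nat) (c : {ffun 'I_N -> 'I_M}) (q : 'I_N)
  : 'M[R[i]]_(N, M) :=
  \matrix_(n < N, p < M) psi_entry c p q n.

(* Psi = [Psi_0, ..., Psi_{N-1}] in C^{N x MN}: column k = q*M + p is psi_{p,q} *)
Definition Psi (M N : nat) (c : {ffun 'I_N -> 'I_M}) : 'M[R[i]]_(N, M * N) :=
  \matrix_(n < N, k < M * N) psi_entry c (k %% M) (k %/ M) n.

Definition mu_I (M N : nat) (c : {ffun 'I_N -> 'I_M}) : R :=
  \big[Num.max/0]_(q < N) specnorm (ctrmx (Psi_blk c q) *m Psi_blk c q - 1%:M).

Definition mu_B (M N : nat) (c : {ffun 'I_N -> 'I_M}) : R :=
  \big[Num.max/0]_(q1 < N) \big[Num.max/0]_(q2 < N | q1 != q2)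
     specnorm (ctrmx (Psi_blk c q1) *m Psi_blk c q2).

(* probability, under C_0..C_{N-1} iid uniform on {0..M-1}, of event E *)
Definition prob_unif (M N : nat) (E : {ffun 'I_N -> 'I_M} -> Prop) : R :=
  (#|[set c : {ffun 'I_N -> 'I_M} | `[< E c >] ]|)%:R / (M ^ N)%:R.

Definition delta1 (M N : nat) (eps : R) : R :=
  24 * Num.sqrt ((M - 1)%:R / N%:R) * ln ((M * N)%:R)
     * (2 * Num.sqrt (ln ((M * N)%:R) - ln eps) + 1).

Definition delta2 (M N : nat) (eps : R) : R :=
  3 / 2 * Num.sqrt ((M - 1)%:R / N%:R)
     * (2 * Num.sqrt (ln ((2 * M)%:R) - ln eps) + 1).

Definition K_bound (M N : nat) (eps : R) : R :=
  N%:R * (1 / 8 - delta1 M N eps - delta2 M N eps) ^+ 2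
  / (81 * M%:R * ln ((M * N)%:R) * (1 + 2 * delta2 M N eps / 3)).

Definition good_event (M N K : nat) (c : {ffun 'I_N -> 'I_M}) : Prop :=
  let L := ln ((M * N)%:R : R) in
  let s := specnorm (Psi c) in
  17 * Num.sqrt (K%:R * L * (1 + mu_I c) / N%:R) * s + 48 * mu_B c * L
  + 2 * K%:R / N%:R * s ^+ 2 + 3 * mu_I c <= 1 / 4.

End Defs.

(* Main.v *)
(* Every Gram block Psi_q1^H Psi_q2 - [q1 = q2] I is circulant, hence
   diagonalized by the M-point DFT, with eigenvalues
     S_k = 1/N sum_n exp(2 pi j (q2 - q1) n / N) (M 1[C_n = k] - 1).
   Their real and imaginary parts are sums of N independent centered bounded
   variables of total variance at most (M - 1)/N.  A Chernoff bound with the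
   moment generating function estimated by exp x <= 1 + x + (1 + o(1)) x^2/2,
   and a union bound over k, q2 - q1 and the signs, give both coherences outside
   an event of probability eps.  Moreover Psi Psi^H = M I, so |Psi|_s <= sqrt M
   surely, and with x = 1/8 - delta1 - delta2 the left-hand side is at most
   17 x/9 + 2 delta1 + x/9 + 2 delta2 = 1/4.                                   *)
Require Import Defs.
From HB Require Import structures.
From mathcomp Require Import all_boot all_order all_algebra.
From mathcomp Require Import all_classical all_reals.
From mathcomp Require Import topology normedtype sequences derive.
From mathcomp Require Import exp trigo.
From mathcomp Require Import complex.
From mathcomp Require Import ring lra zify.
Import Order.TTheory GRing.Theory Num.Theory.
Import numFieldNormedType.Exports.
Local Open Scope ring_scope.
Set Implicit Arguments.
Unset Strict Implicit.
Unset Printing Implicit Defensive.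

(** * Complex exponentials and orthogonality of roots of unity *)

Lemma expiD (R : realType) (s t : R) : expi (s + t) = expi s * expi t.
Proof.
by apply/eqP; rewrite eq_complex /= cosD sinD eqxx /= addrC.
Qed.

Lemma expi0 (R : realType) : expi (0 : R) = 1.
Proof. by rewrite /expi cos0 sin0. Qed.

Lemma expiMn (R : realType) (t : R) (n : nat) : expi (t *+ n) = expi t ^+ n.
Proof.
by elim: n => [|n IH]; rewrite ?expi0 // mulrS expiD IH exprS.
Qed.

Lemma conj_expi (R : realType) (t : R) : conjc (expi t) = expi (- t).
Proof. by rewrite /expi cosN sinN. Qed.

Lemma conj_expiK (R : realType) (t : R) : conjc (expi t) * expi t = 1.
Proof. by rewrite conj_expi -expiD addNr expi0. Qed.

Definition root1 (R : realType) (m : nat) : R[i] := expi (2 * pi / m%:R).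

(** For [0 < j < m] put [t = pi j / m], which lies in [(0, pi)]. The real part of the [j]-th power
    is [cos (2 t) = 1 - 2 sin^2 t], and [sin t > 0] keeps it away from 1. *)
Lemma root1_primitive (R : realType) (m : nat) :
  (0 < m)%N -> m.-primitive_root (root1 R m).
Proof.
move=> m0; have mr : (0 : R) < m%:R by rewrite ltr0n.
have rE j : root1 R m ^+ j = expi (2 * pi * j%:R / m%:R).
  by rewrite -expiMn; congr expi; rewrite -[LHS]mulr_natl mulrA [_ * (2 * pi)]mulrC.
apply/andP; split=> //; apply/forallP => i; apply/eqP; rewrite unity_rootE rE.
have [->|im] := eqVneq i.+1 m.
  rewrite mulfK; last by rewrite gt_eqF.
  by rewrite mulr_natl /expi cos2pi sin2pi eqxx.
have lim : (i.+1 < m)%N by rewrite ltn_neqAle im ltn_ord.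
apply/negbTE; set t := pi * i.+1%:R / m%:R : R.
have -> : 2 * pi * i.+1%:R / m%:R = t *+ 2 by rewrite /t mulr2n; ring.
rewrite eq_complex /= negb_and; apply/orP; left.
have st : 0 < sin t.
  apply: sin_gt0_pi; rewrite /t !divr_gt0 ?mulr_gt0 ?pi_gt0 ?ltr0n//=.
  by rewrite ltr_pdivrMr// ltr_pM2l ?pi_gt0// ltr_nat.
rewrite cos_mulr2n cos2sin2 mulr2n; apply/eqP => h.
have : sin t ^+ 2 = 0 by lra.
by move/eqP; rewrite sqrf_eq0 gt_eqF.
Qed.

Lemma conj_root1K (R : realType) (m : nat) : conjc (root1 R m) * root1 R m = 1.
Proof. exact: conj_expiK. Qed.

(** A geometric sum whose ratio [u] is an [m]-th root of unity. The bounds on [i] and [j] make [u]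
    differ from 1 as soon as [i] and [j] differ, by primitivity. *)
Lemma sum_root1 (R : realType) (m i j : nat) : (i < m)%N -> (j < m)%N ->
  \sum_(k < m) conjc (root1 R m ^+ (i * k)) * root1 R m ^+ (j * k) =
  m%:R * (i == j)%:R.
Proof.
move=> im jm; have m0 : (0 < m)%N by case: m im {jm}.
set z := root1 R m; have pz : m.-primitive_root z by exact: root1_primitive.
have zz : conjc z * z = 1 by exact: conj_root1K.
set u := conjc (z ^+ i) * z ^+ j.
transitivity (\sum_(k < m) u ^+ k).
  by apply: eq_bigr => k _; rewrite !exprM exprMn rmorphXn.
have [ij|ij] := eqVneq i j.
  rewrite /u -ij rmorphXn -exprMn zz expr1n.
  by under eq_bigr do rewrite expr1n; rewrite sumr_const card_ord mulr1.
have um : u ^+ m = 1.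
  rewrite exprMn -[conjc _ ^+ m]rmorphXn -!exprM mulnC exprM (mulnC j).
  by rewrite [z ^+ (m * j)]exprM (prim_expr_order pz) !expr1n rmorph1 mulr1.
have u1 : u != 1.
  apply/eqP => u1; have : z ^+ j == z ^+ i.
    rewrite -[z ^+ j]mul1r -[1](expr1n _ i) -zz exprMn mulrAC.
    by rewrite -rmorphXn -/u u1 mul1r.
  by rewrite (eq_prim_root_expr pz) !modn_small// eq_sym (negbTE ij).
have := subrX1 u m; rewrite um subrr => /esym/eqP.
by rewrite mulf_eq0 subr_eq0 (negbTE u1) /= => /eqP ->; rewrite mulr0.
Qed.

(** * Euclidean norms, adjoints and bounds on the spectral norm *)

Lemma conjcM (R : realType) (u v : R[i]) : conjc (u * v) = conjc u * conjc v.
Proof. exact: rmorphM. Qed.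

Lemma normc_sqr (R : realType) (z : R[i]) :
  ((Normc.normc z) ^+ 2)%:C%C = conjc z * z.
Proof.
by rewrite mulrC -sqr_normc rmorphXn.
Qed.

Lemma vnorm_ge0 (R : realType) n (x : 'cV[R[i]]_n) : 0 <= vnorm x.
Proof. exact: sqrtr_ge0. Qed.

Lemma vnorm_sqr (R : realType) n (x : 'cV[R[i]]_n) :
  vnorm x ^+ 2 = \sum_(i < n) (Normc.normc (x i 0)) ^+ 2.
Proof. by rewrite sqr_sqrtr// sumr_ge0// => i _; rewrite sqr_ge0. Qed.

Lemma vnorm_sqrC (R : realType) n (x : 'cV[R[i]]_n) :
  (vnorm x ^+ 2)%:C%C = (ctrmx x *m x) 0 0.
Proof.
rewrite vnorm_sqr rmorph_sum mxE; apply: eq_bigr => i _.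
by rewrite !mxE; exact: normc_sqr.
Qed.

Lemma ctrmxM (R : realType) m n p (A : 'M[R[i]]_(m, n)) (B : 'M[R[i]]_(n, p)) :
  ctrmx (A *m B) = ctrmx B *m ctrmx A.
Proof. by rewrite /ctrmx trmx_mul map_mxM. Qed.

Lemma ctrmxK (R : realType) m n (A : 'M[R[i]]_(m, n)) : ctrmx (ctrmx A) = A.
Proof. by apply/matrixP => i j; rewrite !mxE conjcK. Qed.

Lemma specnorm_ge0 (R : realType) m n (A : 'M[R[i]]_(m, n)) : 0 <= specnorm A.
Proof.
rewrite /specnorm; set E := (X in sup X).
have [hE|hE] := pselect (has_sup E); last by rewrite sup_out.
have [[r Er] ubE] := hE; apply: le_trans (ub_le_sup ubE Er).
by have [x [_ ->]] := Er; exact: vnorm_ge0.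
Qed.

Lemma specnorm_le (R : realType) m n (A : 'M[R[i]]_(m, n)) (b : R) :
  0 <= b -> (forall x, vnorm (A *m x) ^+ 2 <= b ^+ 2 * vnorm x ^+ 2) ->
  specnorm A <= b.
Proof.
move=> b0 Ab; rewrite /specnorm; set E := (X in sup X).
have ubE : ubound E b.
  move=> r [x [x1 ->]]; rewrite -(@ler_pXn2r _ 2) ?nnegrE ?vnorm_ge0//.
  by have := Ab x; rewrite x1 expr1n mulr1.
have [E0|E0] := pselect (E !=set0)%classic; first exact: ge_sup.
(* With no unit vector ([n = 0]) the set is empty and [sup] defaults to 0, whence the hypothesis
   [0 <= b]. *)
by rewrite sup_out// => -[].
Qed.

(* A scaled co-isometry satisfies 0 <= |c x - A^H A x|^2 = c^2 |x|^2 - c |A x|^2. *)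
Lemma vnorm_coisometry_le (R : realType) m n (A : 'M[R[i]]_(m, n)) (c : R) x :
  0 < c -> A *m ctrmx A = (c%:C%C)%:M ->
  vnorm (A *m x) ^+ 2 <= c * vnorm x ^+ 2.
Proof.
move=> c0 AA.
have : 0 <= vnorm (c%:C%C *: x - ctrmx A *m (A *m x)) ^+ 2 by rewrite sqr_ge0.
set y := A *m x.
have -> : vnorm (c%:C%C *: x - ctrmx A *m y) ^+ 2 =
    c * (c * vnorm x ^+ 2 - vnorm y ^+ 2).
  apply: complexI; rewrite vnorm_sqrC rmorphM rmorphB rmorphM /= !vnorm_sqrC.
  have -> : ctrmx (c%:C%C *: x - ctrmx A *m y) =
      c%:C%C *: ctrmx x - ctrmx y *m A.
    rewrite -[in RHS](ctrmxK A) -ctrmxM; apply/matrixP => i j.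
    by rewrite !mxE rmorphB rmorphM /= oppr0.
  rewrite mulmxBl !mulmxBr -!scalemxAl -!scalemxAr -!mulmxA (mulmxA A) AA.
  rewrite mul_scalar_mx -scalemxAr -/y (mulmxA (ctrmx x)).
  rewrite -ctrmxM -/y !mxE; ring.
by rewrite pmulr_rge0// subr_ge0.
Qed.

Lemma vnorm_isometry (R : realType) m n (A : 'M[R[i]]_(m, n)) (c : R) x :
  ctrmx A *m A = (c%:C%C)%:M -> vnorm (A *m x) ^+ 2 = c * vnorm x ^+ 2.
Proof.
move=> AA; apply: complexI; rewrite vnorm_sqrC rmorphM /= vnorm_sqrC ctrmxM.
by rewrite mulmxA -(mulmxA (ctrmx x)) AA mul_mx_scalar -scalemxAl !mxE.
Qed.

(** Undoes the column numbering [k = q * M + p] of [Psi], so that a sum over its columns becomes a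
    double sum over blocks and carrier frequencies. *)
Lemma sum_divmod (V : nmodType) (M N : nat) (f : nat -> nat -> V) : (0 < M)%N ->
  \sum_(k < M * N) f (k %% M)%N (k %/ M)%N = \sum_(q < N) \sum_(p < M) f p q.
Proof.
move=> M0; rewrite -(big_mkord xpredT (fun k => f (k %% M)%N (k %/ M)%N)).
rewrite mulnC big_nat_mul big_mkord; apply: eq_bigr => q _.
rewrite -{1}[(q * M)%N]add0n mulSn big_addn addnK big_mkord.
by apply: eq_bigr => p _; rewrite addnC modnMDl divnMDl// divn_small// modn_small ?addn0.
Qed.

(** * Singular values of the sensing matrix and of its blocks *)

Section Coherence.
Variables (R : realType) (M N : nat) (c : {ffun 'I_N -> 'I_M}).
Hypotheses (hM : (0 < M)%N) (hN : (0 < N)%N).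
Let rt : R[i] := ((Num.sqrt (N%:R : R))^-1)%:C%C.
Let zM := root1 R M.
Let zN := root1 R N.

Lemma rt_sqr : rt * rt * N%:R = 1.
Proof.
rewrite /rt -[X in _ * X](rmorph_nat (real_complex R)) -!rmorphM /=.
rewrite -{3}(@sqr_sqrtr _ (N%:R : R)) ?ler0n//.
suff -> : (Num.sqrt (N%:R : R))^-1 / Num.sqrt N%:R * Num.sqrt N%:R ^+ 2 = 1 by [].
by field; rewrite gt_eqF// sqrtr_gt0 ltr0n.
Qed.

Lemma conj_rt : conjc rt = rt. Proof. exact: conjc_real. Qed.

Lemma psi_entryE p q (n : 'I_N) :
  psi_entry R c p q n = rt * (zM ^+ (p * c n) * zN ^+ (q * n)).
Proof.
rewrite /psi_entry expiD /zM /zN /root1 -!expiMn; congr (_ * (expi _ * expi _)).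
  by rewrite -[RHS]mulr_natl natrM; ring.
by rewrite -[RHS]mulr_natl natrM; ring.
Qed.

(** Entry [(n, n')] factors into a sum over [p] and a sum over [q]. The latter is [N [n = n']],
    which kills the off-diagonal entries whatever [c] is; on the diagonal the former is [M]. *)
Lemma Psi_mul_ctr : Psi R c *m ctrmx (Psi R c) = ((M%:R : R)%:C%C)%:M.
Proof.
apply/matrixP => n n'; rewrite !mxE.
pose f p q := psi_entry R c p q n * conjc (psi_entry R c p q n').
transitivity (\sum_(k < M * N) f (k %% M)%N (k %/ M)%N).
  by apply: eq_bigr => k _; rewrite !mxE.
rewrite sum_divmod//.
transitivity (rt * rt * (\sum_(p < M) conjc (zM ^+ (c n' * p)) * zM ^+ (c n * p)) *
   \sum_(q < N) conjc (zN ^+ (n' * q)) * zN ^+ (n * q)).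
  rewrite -mulrA [X in _ * X]mulrC mulr_suml mulr_sumr; apply: eq_bigr => q _.
  rewrite mulr_sumr mulr_sumr; apply: eq_bigr => p _.
  rewrite /f !psi_entryE !conjcM conj_rt.
  by rewrite ![(p * _)%N]mulnC ![(q * _)%N]mulnC; ring.
rewrite !sum_root1//; have [->|nn] := eqVneq n n'; last first.
  have -> : (n' == n :> nat) = false by rewrite eq_sym; exact/negbTE.
  by rewrite mulr0n !mulr0.
by rewrite !eqxx !mulr1 mulrAC rt_sqr mul1r rmorph_nat.
Qed.

Lemma specnorm_Psi_le : specnorm (Psi R c) <= Num.sqrt M%:R.
Proof.
apply: specnorm_le => [|x]; first exact: sqrtr_ge0.
rewrite [X in X * _]sqr_sqrtr ?ler0n//; apply: vnorm_coisometry_le.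
  by rewrite ltr0n.
exact: Psi_mul_ctr.
Qed.

Let F : 'M[R[i]]_M := \matrix_(k, p) zM ^+ (k * p).

Lemma dft_isometry : ctrmx F *m F = ((M%:R : R)%:C%C)%:M.
Proof.
apply/matrixP => p p'; rewrite !mxE.
transitivity (\sum_(k < M) conjc (zM ^+ (p * k)) * zM ^+ (p' * k)).
  by apply: eq_bigr => k _; rewrite !mxE ![(k * _)%N]mulnC.
by rewrite sum_root1// val_eqE rmorph_nat mulr_natr.
Qed.

Lemma dft_coisometry : F *m ctrmx F = ((M%:R : R)%:C%C)%:M.
Proof.
apply/matrixP => p p'; rewrite !mxE.
transitivity (\sum_(k < M) conjc (zM ^+ (p' * k)) * zM ^+ (p * k)).
  by apply: eq_bigr => k _; rewrite !mxE mulrC.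
by rewrite sum_root1// val_eqE eq_sym rmorph_nat mulr_natr.
Qed.

(* The eigenvalues of the circulant matrix Psi_q1^H Psi_q2 - [q1 = q2] I. *)
Definition coh_eig (q1 q2 : 'I_N) (k : 'I_M) : R[i] :=
  N%:R^-1 * \sum_(n < N) conjc (zN ^+ (q1 * n)) * zN ^+ (q2 * n) *
    (M%:R * (c n == k)%:R - 1).

(** Both sides are compared entrywise. Orthogonality over [k] turns the right-hand side into the
    Gram entry minus a term in [[p = p']]; orthogonality over [n] then reduces the coefficient of
    that term to [[q1 = q2]]. *)
Lemma gram_blkE (q1 q2 : 'I_N) :
  ctrmx (Psi_blk R c q1) *m Psi_blk R c q2 - (q1 == q2)%:R%:M =
  (M%:R^-1 : R[i]) *: (ctrmx F *m diag_mx (\row_k coh_eig q1 q2 k) *m F).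
Proof.
have nz (m : nat) : (0 < m)%N -> (m%:R : R[i]) != 0 by rewrite pnatr_eq0 lt0n.
have rtN : rt * rt = N%:R^-1 by apply: (mulIf (nz _ hN)); rewrite rt_sqr mulVf ?nz.
apply/matrixP => p p'; rewrite mul_mx_diag !mxE.
transitivity (M%:R^-1 * (N%:R^-1 * \sum_(n < N) (conjc (zN ^+ (q1 * n)) * zN ^+ (q2 * n) *
   \sum_(k < M) (M%:R * (c n == k)%:R - 1) * (conjc (zM ^+ (p * k)) * zM ^+ (p' * k))))).
  transitivity (N%:R^-1 * (\sum_(n < N) (conjc (zN ^+ (q1 * n)) * zN ^+ (q2 * n) *
      (conjc (zM ^+ (p * c n)) * zM ^+ (p' * c n)))) - (q1 == q2)%:R * (p == p')%:R).
    congr (_ - _); last by rewrite mulr_natr.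
    rewrite mulr_sumr; apply: eq_bigr => n _.
    by rewrite !mxE !psi_entryE !conjcM conj_rt -rtN; ring.
  (* The indicator selects the phase at [c n], while the [- 1] leaves a full sum of roots of
     unity. *)
  have sumk n : \sum_(k < M) (M%:R * (c n == k)%:R - 1) *
        (conjc (zM ^+ (p * k)) * zM ^+ (p' * k)) =
      M%:R * (conjc (zM ^+ (p * c n)) * zM ^+ (p' * c n)) - M%:R * (p == p')%:R.
    under eq_bigr do rewrite mulrBl mul1r.
    rewrite sumrB sum_root1// (bigD1 (c n))//= eqxx mulr1 big1 ?addr0//.
    by move=> k /negbTE; rewrite eq_sym => ->; rewrite mulr0 mul0r.
  under [in RHS]eq_bigr do rewrite sumk mulrBr.
  rewrite sumrB -mulr_suml sum_root1//.
  have -> : \sum_(n < N) conjc (zN ^+ (q1 * n)) * zN ^+ (q2 * n) *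
      (M%:R * (conjc (zM ^+ (p * c n)) * zM ^+ (p' * c n))) =
      M%:R * \sum_(n < N) conjc (zN ^+ (q1 * n)) * zN ^+ (q2 * n) *
      (conjc (zM ^+ (p * c n)) * zM ^+ (p' * c n)).
    by rewrite mulr_sumr; apply: eq_bigr => n _; ring.
  by rewrite val_eqE; field; rewrite !nz.
congr (_ * _); rewrite mulr_sumr.
under eq_bigr do rewrite !mulr_sumr.
rewrite exchange_big; apply: eq_bigr => k _ /=.
rewrite !mxE /coh_eig !mulr_sumr mulr_suml.
by apply: eq_bigr => n _; rewrite ![(k * _)%N]mulnC; ring.
Qed.

(** [F / sqrt M] is unitary, so conjugating by it preserves norms and only the largest diagonal
    entry matters. *)
Lemma specnorm_gram_le (q1 q2 : 'I_N) (b : R) : 0 <= b ->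
  (forall k, Normc.normc (coh_eig q1 q2 k) ^+ 2 <= b ^+ 2) ->
  specnorm (ctrmx (Psi_blk R c q1) *m Psi_blk R c q2 - (q1 == q2)%:R%:M) <= b.
Proof.
move=> b0 hb; apply: specnorm_le => // x; rewrite gram_blkE.
have m0 : (0 : R) < M%:R by rewrite ltr0n.
set D := diag_mx _; set y := F *m x.
have Dy : vnorm (D *m y) ^+ 2 <= b ^+ 2 * vnorm y ^+ 2.
  rewrite !vnorm_sqr mulr_sumr ler_sum// => k _.
  rewrite mul_diag_mx !mxE Normc.normcM exprMn ler_wpM2r ?sqr_ge0//.
have -> : ((M%:R^-1 : R[i]) *: (ctrmx F *m D *m F)) *m x =
    (M%:R^-1 : R[i]) *: (ctrmx F *m (D *m y)) by rewrite -scalemxAl !mulmxA.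
have scale n (a : R) (z : 'cV[R[i]]_n) : vnorm (a%:C%C *: z) ^+ 2 = a ^+ 2 * vnorm z ^+ 2.
  rewrite !vnorm_sqr mulr_sumr; apply: eq_bigr => i _.
  rewrite mxE Normc.normcM exprMn; congr (_ * _).
  by rewrite /= expr0n addr0 sqr_sqrtr ?sqr_ge0.
have -> : (M%:R^-1 : R[i]) = ((M%:R^-1 : R)%:C)%C by rewrite fmorphV rmorph_nat.
rewrite scale (@vnorm_isometry _ _ _ _ M%:R); last by rewrite ctrmxK dft_coisometry.
have yx : vnorm y ^+ 2 = M%:R * vnorm x ^+ 2 by exact/vnorm_isometry/dft_isometry.
rewrite yx in Dy.
rewrite (_ : b ^+ 2 * _ = M%:R^-1 ^+ 2 * (M%:R * (b ^+ 2 * (M%:R * vnorm x ^+ 2)))).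
  by rewrite ler_pM2l ?exprn_gt0 ?invr_gt0// ler_pM2l.
by field; rewrite gt_eqF.
Qed.

End Coherence.

(** * Chernoff bound *)

(** The ratio [h] of the quadratic to the exponential equals 1 at 0. Its derivative [h'] is
    nonpositive for [y < 0] and nonnegative on [[0, 2b / (1 + b)]], an interval containing [[0, b]]
    because [b <= 1]. *)
Lemma expR_le_quadratic (R : realType) (b x : R) :
  0 <= b <= 1 -> x <= b -> expR x <= 1 + x + (1 + b) / 2 * x ^+ 2.
Proof.
move=> /andP[b0 b1] xb.
pose h (y : R) := (1 + y + (1 + b) / 2 * y ^+ 2) * expR (- y).
pose h' (y : R) := y * (b - (1 + b) / 2 * y) * expR (- y).
have dh (y : R) : is_derive y (1 : R) h (h' y).
  apply: is_derive_eq.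
  by rewrite /h' /GRing.scale /=; field.
have h0 : h 0 = 1 by rewrite /h oppr0 expR0; ring.
suff h1 : 1 <= h x.
  have h2 : 1 * expR x <= h x * expR x by rewrite ler_wpM2r ?expR_ge0.
  rewrite mul1r in h2; apply: (le_trans h2).
  by rewrite /h -mulrA expRN mulVf ?mulr1// gt_eqF ?expR_gt0.
have ch : continuous h.
  by move=> y; apply/differentiable_continuous/derivable1_diffP.
case: (ltgtP x 0) => [x0|x0|xe]; last by rewrite xe h0.
- have [c] := MVT x0 (fun y _ => dh y) (continuous_subspaceT ch).
  rewrite in_itv/= h0 => /andP[xc c0] /eqP; rewrite subr_eq => /eqP h1.
  have : 0 <= (- c) * (b - (1 + b) / 2 * c) * expR (- c) * (- x).
    by rewrite !mulr_ge0 ?expR_ge0//; nra.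
  by rewrite /h' in h1 *; nra.
- have [c] := MVT x0 (fun y _ => dh y) (continuous_subspaceT ch).
  rewrite in_itv/= h0 => /andP[c0 cx] /eqP; rewrite subr_eq => /eqP ->.
  rewrite ler_wpDl// /h' !mulr_ge0 ?expR_ge0 ?subr_ge0//; nra.
Qed.

(** With cosine or sine weights this is, up to sign, [N] times the real or imaginary part of an
    eigenvalue [coh_eig]. Under the uniform law each factor [M [c n = k] - 1] has mean 0 and
    variance [M - 1]. *)
Definition dev (R : realType) (M N : nat) (w : 'I_N -> R) (k : 'I_M)
    (c : {ffun 'I_N -> 'I_M}) : R :=
  \sum_(n < N) w n * (M%:R * (c n == k)%:R - 1).

(** The quadratic bound is applied with [b = |l| M]. Summed over [a], the linear term vanishes and
    the squares give [M (M - 1)]; then [1 + x <= exp x]. *)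
Lemma mgf_indicator (R : realType) (M : nat) (k : 'I_M) (l : R) :
  (2 <= M)%N -> `|l| * M%:R <= 1 ->
  \sum_(a < M) expR (l * (M%:R * (a == k)%:R - 1)) <=
  M%:R * expR ((1 + `|l| * M%:R) / 2 * l ^+ 2 * (M%:R - 1)).
Proof.
move=> hM lM; set m : R := M%:R; set b := `|l| * m.
have m2 : 2 <= m by rewrite /m ler_nat.
have b0 : 0 <= b by rewrite mulr_ge0//; lra.
pose y (a : 'I_M) := m * (a == k)%:R - 1.
have s1 : \sum_(a < M) (a == k)%:R = 1 :> R.
  by rewrite (bigD1 k)//= eqxx big1 ?addr0// => i /negbTE ->.
have sumc (r : R) : \sum_(a < M) r = m * r.
  by rewrite sumr_const card_ord -mulr_natl.
have le1 a : expR (l * y a) <= 1 + l * y a + (1 + b) / 2 * (l * y a) ^+ 2.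
  apply: expR_le_quadratic; first by rewrite b0.
  rewrite (le_trans (ler_norm _))// normrM ler_wpM2l// /y.
  by case: (a == k); rewrite ?mulr1 ?mulr0 ?sub0r ?normrN ger0_norm//; lra.
apply: (le_trans (ler_sum _ (fun a _ => le1 a))).
rewrite (_ : \sum_(a < M) _ =
    m * (1 + (1 + b) / 2 * l ^+ 2 * (m - 1))); last first.
  transitivity (\sum_(a < M) ((1 - l + (1 + b) / 2 * l ^+ 2) +
      (l * m + (1 + b) / 2 * l ^+ 2 * (m ^+ 2 - 2 * m)) * (a == k)%:R)).
    by apply: eq_bigr => a _; rewrite /y; case: (a == k); rewrite ?mulr1 ?mulr0; field.
  by rewrite big_split/= -mulr_sumr s1 sumc; field.
by rewrite ler_wpM2l ?expR_ge1Dx//; lra.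
Qed.

(** The parameter [T / V] minimizes the Gaussian exponent [- l T + l^2 V / 2]; the factor
    [1 - T M / V] is the price of the correction [b] in the quadratic bound. The exponential moment
    itself is kept, rather than a probability, so that moments can be added in the union bound. *)
Lemma chernoff_dev (R : realType) (M N : nat) (w : 'I_N -> R) (k : 'I_M) (T : R) :
  (2 <= M)%N -> (0 < N)%N -> (forall n, `|w n| <= 1) ->
  let V : R := N%:R * (M%:R - 1) in
  0 <= T -> T * M%:R <= V ->
  \sum_(c : {ffun 'I_N -> 'I_M}) expR (T / V * (dev w k c - T)) <=
  (M ^ N)%:R * expR (- (T ^+ 2 / (2 * V) * (1 - T * M%:R / V))).
Proof.
move=> hM N0 w1 V T0 TV.
have m2 : (2 : R) <= M%:R by rewrite ler_nat.
have n0 : (0 : R) < N%:R by rewrite ltr0n.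
have V0 : 0 < V by rewrite mulr_gt0//; lra.
set l := T / V; have l0 : 0 <= l by rewrite divr_ge0// ltW.
have lM : l * M%:R <= 1 by rewrite /l mulrAC ler_pdivrMr// mul1r.
apply: (@le_trans _ _ (expR (- (l * T)) * \sum_(c : {ffun 'I_N -> 'I_M})
    \prod_(n < N) expR (l * w n * (M%:R * (c n == k)%:R - 1)))).
  rewrite mulr_sumr ler_sum// => c _; rewrite -expR_sum -expRD ler_expR.
  rewrite /dev mulrBr mulr_sumr addrC lerD2l ler_sum// => n _.
  by rewrite mulrA.
(* Independence: the sum over all [c] of a product is the product of the sums over single draws. *)
rewrite -(bigA_distr_bigA (fun n a => expR (l * w n * (M%:R * (a == k)%:R - 1)))).
apply: (@le_trans _ _ (expR (- (l * T)) * \prod_(n < N)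
    (M%:R * expR ((1 + l * M%:R) / 2 * l ^+ 2 * (M%:R - 1))))).
  rewrite ler_wpM2l ?expR_ge0// ler_prod// => n _.
  rewrite sumr_ge0/=; last by move=> a _; exact: expR_ge0.
  have lw : `|l * w n| <= l by rewrite normrM (ger0_norm l0) ler_piMr.
  have lw2 : (l * w n) ^+ 2 <= l ^+ 2 by rewrite -real_normK ?num_real// lerXn2r ?nnegrE.
  apply: (le_trans (mgf_indicator _ _ _)) => //.
    by apply: le_trans lM; rewrite ler_wpM2r//; lra.
  rewrite ler_wpM2l ?ler_expR; try lra.
  have lwM : `|l * w n| * M%:R <= l * M%:R by rewrite ler_wpM2r//; lra.
  have lwM0 : 0 <= `|l * w n| * M%:R by rewrite mulr_ge0//; lra.
  apply: ler_wpM2r; first by lra.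
  by apply: ler_pM => //; rewrite ?sqr_ge0//; lra.
rewrite prodr_const card_ord exprMn -natrX -expRM_natl mulrCA -expRD.
rewrite ler_wpM2l// ler_expR le_eqVlt; apply/orP; left; apply/eqP.
by rewrite /l /V; field; rewrite ?gt_eqF//; lra.
Qed.

(** * Trigonometric weights and the two coherences *)

Definition cos_wt (R : realType) (N d : nat) (n : 'I_N) : R :=
  cos (2 * pi / N%:R *+ (d * n)).

Definition sin_wt (R : realType) (N d : nat) (n : 'I_N) : R :=
  sin (2 * pi / N%:R *+ (d * n)).

Lemma normcJ (R : realType) (z : R[i]) : Normc.normc (conjc z) = Normc.normc z.
Proof. by case: z => x y /=; rewrite sqrrN. Qed.

(** The eigenvalue depends only on [q2 - q1], and a negative difference merely conjugates it. Hence
    [N] values of [d] suffice instead of all pairs of blocks, which keeps the union bound of order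
    [M N]. *)
Lemma normc_coh_eig (R : realType) (M N : nat) (c : {ffun 'I_N -> 'I_M})
    (q1 q2 : 'I_N) (k : 'I_M) :
  exists2 d : 'I_N, ((d == 0%N :> nat) = (q1 == q2)) &
  Normc.normc (coh_eig R c q1 q2 k) ^+ 2 =
  (dev (@cos_wt R N d) k c ^+ 2 + dev (@sin_wt R N d) k c ^+ 2) / N%:R ^+ 2.
Proof.
set z := root1 R N.
have zz j : conjc (z ^+ j) * z ^+ j = 1.
  by rewrite rmorphXn -exprMn conj_root1K expr1n.
pose A (d : nat) : R[i] := \sum_(n < N) z ^+ (d * n) * (M%:R * (c n == k)%:R - 1).
have AE d : A d = (dev (@cos_wt R N d) k c +i* dev (@sin_wt R N d) k c)%C.
  rewrite /A /dev [RHS]complexE !rmorph_sum mulr_sumr -big_split /=.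
  apply: eq_bigr => n _; rewrite /z /root1 -expiMn !rmorphM /=.
  rewrite mulrA -mulrDl; congr (_ * _); first by rewrite [LHS]complexE.
  by rewrite rmorphB rmorphM rmorph1 !rmorph_nat.
have main (B : R[i]) d : B = A d \/ B = conjc (A d) ->
    Normc.normc (N%:R^-1 * B) ^+ 2 =
    (dev (@cos_wt R N d) k c ^+ 2 + dev (@sin_wt R N d) k c ^+ 2) / N%:R ^+ 2.
  move=> hB; rewrite Normc.normcM exprMn mulrC.
  have -> : Normc.normc B = Normc.normc (A d) by case: hB => -> //; rewrite normcJ.
  rewrite AE sqr_sqrtr ?addr_ge0 ?sqr_ge0//; congr (_ * _).
  rewrite -(rmorph_nat (real_complex R)) -fmorphV /= expr0n addr0 sqr_sqrtr ?sqr_ge0//.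
  by rewrite exprVn.
have [q12|q21] := leqP q1 q2.
- have dN : (q2 - q1 < N)%N by rewrite (leq_ltn_trans (leq_subr _ _)).
  exists (Ordinal dN) => /=.
    by rewrite subn_eq0 -[RHS]val_eqE eqn_leq q12.
  apply: main; left; apply: eq_bigr => n _; congr (_ * _).
  by rewrite -{1}(subnK q12) mulnDl exprD mulrCA zz mulr1.
- have dN : (q1 - q2 < N)%N by rewrite (leq_ltn_trans (leq_subr _ _)).
  exists (Ordinal dN) => /=.
    by rewrite subn_eq0 -[RHS]val_eqE eqn_leq leqNgt q21.
  apply: main; right; rewrite rmorph_sum; apply: eq_bigr => n _.
  rewrite rmorphM; congr (_ * _); last first.
    by rewrite rmorphB rmorphM rmorph1 /= !conjc_nat.
  by rewrite -{1}(subnK (ltnW q21)) mulnDl exprD conjcM -mulrA zz mulr1.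
Qed.

(* Threshold for the real and imaginary parts of [N S_k]; bounding both gives
   [|S_k| <= coh_bound], the sqrt 2 lost in doing so being the [/ 2] here. *)
Definition cutoff (R : realType) (M N : nat) (u : R) : R :=
  Num.sqrt (N%:R * (M%:R - 1) / 2) * (1 + 2 * Num.sqrt u).

(** The factor common to [delta1] and [delta2], each with its own [u]. *)
Definition coh_bound (R : realType) (M N : nat) (u : R) : R :=
  Num.sqrt ((M - 1)%:R / N%:R) * (2 * Num.sqrt u + 1).

Lemma coh_bound_ge0 (R : realType) (M N : nat) (u : R) : 0 <= coh_bound M N u.
Proof. by rewrite mulr_ge0 ?sqrtr_ge0// addr_ge0// mulr_ge0 ?sqrtr_ge0. Qed.

Lemma cutoff_sqr (R : realType) (M N : nat) (u : R) : (0 < M)%N -> (0 < N)%N ->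
  2 * cutoff M N u ^+ 2 / N%:R ^+ 2 = coh_bound M N u ^+ 2.
Proof.
move=> M0 N0; have n0 : (0 : R) < N%:R by rewrite ltr0n.
have m1 : (1 : R) <= M%:R by rewrite ler1n.
rewrite /cutoff /coh_bound natrB// !exprMn !sqr_sqrtr.
- by field; rewrite gt_eqF.
- by rewrite divr_ge0 ?subr_ge0// ltW.
- by rewrite divr_ge0 ?mulr_ge0 ?subr_ge0// ltW.
Qed.

Lemma cutoff_ge0 (R : realType) (M N : nat) (u : R) : 0 <= cutoff M N u.
Proof. by rewrite mulr_ge0 ?sqrtr_ge0// addr_ge0// mulr_ge0 ?sqrtr_ge0. Qed.

Lemma ler_sqr_norm (R : realType) (x t : R) : `|x| <= t -> x ^+ 2 <= t ^+ 2.
Proof.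
move=> xt; have t0 : 0 <= t := le_trans (normr_ge0 _) xt.
by rewrite -real_normK ?num_real// lerXn2r ?nnegrE.
Qed.

Lemma mu_I_le (R : realType) (M N : nat) (c : {ffun 'I_N -> 'I_M}) (u : R) :
  (0 < M)%N -> (0 < N)%N ->
  (forall k, `|dev (@cos_wt R N 0) k c| <= cutoff M N u) ->
  mu_I R c <= coh_bound M N u.
Proof.
move=> M0 N0 hdev; apply: bigmax_le => [|q _]; first exact: coh_bound_ge0.
have := @specnorm_gram_le R M N c M0 N0 q q _ (coh_bound_ge0 M N u).
rewrite eqxx; apply => k.
have [d] := normc_coh_eig R c q q k; rewrite eqxx => /eqP ->.
rewrite -cutoff_sqr// => ->; rewrite ler_wpM2r ?invr_ge0 ?exprn_ge0//.
(* For [d = 0] the eigenvalue is real, so only [M] deviations, each with two signs, have to be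
   controlled: this is the [2 M] inside [delta2]. *)
have -> : dev (@sin_wt R N 0) k c = 0.
  by apply: big1 => n _; rewrite /sin_wt mul0n sin0 mul0r.
have := ler_sqr_norm (hdev k); have := sqr_ge0 (cutoff M N u).
by rewrite expr0n/=; lra.
Qed.

Lemma mu_B_le (R : realType) (M N : nat) (c : {ffun 'I_N -> 'I_M}) (u : R) :
  (0 < M)%N -> (0 < N)%N ->
  (forall (d : 'I_N) k, `|dev (@cos_wt R N d) k c| <= cutoff M N u /\
      `|dev (@sin_wt R N d) k c| <= cutoff M N u) ->
  mu_B R c <= coh_bound M N u.
Proof.
move=> M0 N0 hdev; apply: bigmax_le => [|q1 _]; first exact: coh_bound_ge0.
apply: bigmax_le => [|q2 q12]; first exact: coh_bound_ge0.
have := @specnorm_gram_le R M N c M0 N0 q1 q2 _ (coh_bound_ge0 M N u).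
rewrite (negbTE q12) mulr0n raddf0 subr0; apply => k.
have [d _] := normc_coh_eig R c q1 q2 k.
rewrite -cutoff_sqr// => ->; rewrite ler_wpM2r ?invr_ge0 ?exprn_ge0//.
have [/ler_sqr_norm + /ler_sqr_norm] := hdev d k; lra.
Qed.

(** With [v = sqrt u] and [s = 1 + 2 v], the main exponent [T^2 / (2 V)] is
    [s^2 / 4 = 1/4 + v + v^2]. The correction costs at most [1/4], which leaves [v + u]; the surplus
    [v] later absorbs the constants of the union bound. *)
Lemma chernoff_cutoff (R : realType) (M N : nat) (w : 'I_N -> R) (k : 'I_M) (u : R) :
  (2 <= M)%N -> (0 < N)%N -> (forall n, `|w n| <= 1) -> 0 <= u ->
  M%:R * (1 + 2 * Num.sqrt u) ^+ 6 <= N%:R ->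
  \sum_(c : {ffun 'I_N -> 'I_M}) expR (cutoff M N u / (N%:R * (M%:R - 1)) *
    (dev w k c - cutoff M N u)) <=
  (M ^ N)%:R * expR (- (Num.sqrt u + u)).
Proof.
move=> hM N0 w1 u0 hN; set T := cutoff M N u.
have m2 : (2 : R) <= M%:R by rewrite ler_nat.
have n0 : (0 : R) < N%:R by rewrite ltr0n.
set V := N%:R * (M%:R - 1); have V0 : 0 < V by rewrite mulr_gt0//; lra.
have v0 := sqrtr_ge0 u; have vv : Num.sqrt u ^+ 2 = u by rewrite sqr_sqrtr.
set v := Num.sqrt u in hN v0 vv *; set s := 1 + 2 * v.
have s1 : 1 <= s by rewrite /s; lra.
have T0 : 0 <= T by exact: cutoff_ge0.
have TT : T ^+ 2 = V / 2 * s ^+ 2.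
  by rewrite /T /cutoff exprMn sqr_sqrtr// divr_ge0// ltW.
(* After squaring, the claim is [M^2 s^6 / 2 <= V]. It follows from [M s^6 <= N] and
   [M / 2 <= M - 1]; this is where the sixth power comes from. *)
clearbody T; have TVs : T * M%:R * s ^+ 2 <= V.
  rewrite -(@ler_pXn2r _ 2)// ?nnegrE; last 2 first.
  - by rewrite !mulr_ge0// (le_trans _ s1).
  - exact: ltW.
  have -> : (T * M%:R * s ^+ 2) ^+ 2 = T ^+ 2 * M%:R ^+ 2 * s ^+ 4
    by ring.
  rewrite TT; have -> : V / 2 * s ^+ 2 * M%:R ^+ 2 * s ^+ 4 =
    V / 2 * M%:R * (M%:R * s ^+ 6) by ring.
  apply: (@le_trans _ _ (V / 2 * M%:R * N%:R)).
    by rewrite ler_wpM2l// mulr_ge0// divr_ge0// ltW.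
  have -> : V / 2 * M%:R * N%:R = V * (M%:R * N%:R / 2) by ring.
  have MV : M%:R * N%:R / 2 <= V by rewrite /V; nra.
  by rewrite expr2 ler_wpM2l// ltW.
have TV : T * M%:R <= V.
  apply: le_trans TVs; rewrite ler_peMr ?mulr_ge0// expr2; nra.
apply: (le_trans (chernoff_dev k hM N0 w1 T0 TV)).
rewrite ler_wpM2l// ler_expR lerN2 TT -/V.
have -> : V / 2 * s ^+ 2 / (2 * V) * (1 - T * M%:R / V) =
    (s ^+ 2 - T * M%:R * s ^+ 2 / V) / 4 by field; rewrite gt_eqF.
have : T * M%:R * s ^+ 2 / V <= 1 by rewrite ler_pdivrMr// mul1r.
by rewrite /s; nra.
Qed.

(** * Union bound over deviations, frequencies and signs *)

(** Markov's inequality and the union bound in one: the sum of the [g j] dominates the indicator of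
    the complement of [E]. *)
Lemma prob_unif_ge (R : realType) (M N : nat) (J : finType)
    (E : {ffun 'I_N -> 'I_M} -> Prop) (g : J -> {ffun 'I_N -> 'I_M} -> R) :
  (0 < M)%N -> (forall j c, 0 <= g j c) ->
  (forall c, ~ E c -> exists j, 1 <= g j c) ->
  1 - (\sum_j \sum_c g j c) / (M ^ N)%:R <= prob_unif R E.
Proof.
move=> M0 g0 hg; have q0 : (0 : R) < (M ^ N)%:R by rewrite ltr0n expn_gt0 M0.
rewrite /prob_unif -(ler_pM2r q0) mulrBl !divfK ?gt_eqF// mul1r lerBlDr.
have -> : (M ^ N)%:R = \sum_(c : {ffun 'I_N -> 'I_M}) (1 : R).
  by rewrite sumr_const card_ffun !card_ord.
rewrite -sum1_card natr_sum [X in X + _]big_mkcond/=.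
rewrite [X in _ + X]exchange_big -big_split ler_sum//= => c _.
have [Ec|Ec] := boolP (c \in _); first by rewrite lerDl sumr_ge0.
have {}Ec : ~ E c.
  by move=> hE; move/negP: Ec; apply; apply/asboolP; exact/asboolP.
have [j gj] := hg c Ec; rewrite add0r (bigD1 j)//=.
by rewrite (le_trans gj)// lerDl sumr_ge0.
Qed.

(** Putting the sign into the weights lets the one-sided Chernoff bound serve both tails. *)
Definition sgn_wt (R : realType) (N : nat) (b : bool) (w : 'I_N -> R) (n : 'I_N) : R :=
  (-1) ^+ b * w n.

Lemma dev_sgn (R : realType) (M N : nat) b (w : 'I_N -> R) (k : 'I_M) c :
  dev (sgn_wt b w) k c = (-1) ^+ b * dev w k c.
Proof. by rewrite mulr_sumr; apply: eq_bigr => n _; rewrite mulrA. Qed.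

Lemma dev_gt_sgn (R : realType) (M N : nat) (w : 'I_N -> R) (k : 'I_M) c (T : R) :
  ~ `|dev w k c| <= T -> exists b, T <= dev (sgn_wt b w) k c.
Proof.
move/negP; rewrite -ltNge => h; exists (dev w k c < 0).
by rewrite dev_sgn -normrEsign ltW.
Qed.

Lemma sgn_wt_le1 (R : realType) (N : nat) b (w : 'I_N -> R) n :
  `|w n| <= 1 -> `|sgn_wt b w n| <= 1.
Proof. by rewrite normrM normrX normrN1 expr1n mul1r. Qed.

(** The [2 M] intra-block moments contribute [eps exp (- sqrt uI)] in total, and the [4 M N]
    inter-block ones [4 eps exp (- sqrt uB)]. The two exponentials are at most [1/2] and [1/8], so
    the sum is at most [eps]. *)
Lemma mu_prob (R : realType) (M N : nat) (eps : R) :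
  (2 <= M)%N -> (0 < N)%N -> 0 < eps -> eps < 1 ->
  let uI := ln ((2 * M)%:R) - ln eps in
  let uB := ln ((M * N)%:R) - ln eps in
  M%:R * (1 + 2 * Num.sqrt uI) ^+ 6 <= N%:R ->
  M%:R * (1 + 2 * Num.sqrt uB) ^+ 6 <= N%:R ->
  3 <= Num.sqrt uB ->
  1 - eps <= @prob_unif R M N (fun c => mu_I R c <= coh_bound M N uI /\
                              mu_B R c <= coh_bound M N uB).
Proof.
move=> hM N0 e0 e1 uI uB hI hB uB3.
have M0 : (0 < M)%N by apply: leq_trans hM.
have le1D x : 1 + x <= expR x :> R := expR_ge1Dx x.
have eN (a : nat) : (0 < a)%N -> expR (- (ln a%:R - ln eps)) = eps / a%:R.
  by move=> a0; rewrite opprB expRD expRN !lnK// posrE ltr0n.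
have eI : expR (- uI) = eps / (2 * M)%:R by apply: eN; rewrite muln_gt0.
have eB : expR (- uB) = eps / (M * N)%:R by apply: eN; rewrite muln_gt0 M0.
have q0 : (0 : R) < (M ^ N)%:R by rewrite ltr0n expn_gt0 M0.
(* Here [exp (- uI) = eps / (2 M) <= 1/4 <= exp (- 1)], the last step by squaring
   [1/2 <= exp (- 1/2)]. *)
have uI1 : 1 <= uI.
  have := le1D (- uI); rewrite eI => h.
  have : eps / (2 * M)%:R <= 1 / 4.
    rewrite ler_pdivrMr ?ltr0n ?muln_gt0// natrM.
    have : (2 : R) <= M%:R by rewrite ler_nat.
    by lra.
  have h2 := le1D (- (1 / 2)); have h3 : expR (- 1 : R) = expR (- (1 / 2)) ^+ 2.
    by rewrite -expRM_natl; congr expR; field.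
  move=> h4; rewrite -ler_expR; rewrite -lef_pV2 ?posrE ?expR_gt0// -!expRN eI.
  by rewrite (le_trans h4)// h3; nra.
have uB0 : 0 <= uB.
  by rewrite leNgt; apply/negP => /ltW/ler0_sqrtr h; rewrite h in uB3; lra.
(* Left: the eigenvalue index and a sign, for [d = 0]. Right: [d], the eigenvalue index, cosine or
   sine, and a sign. *)
pose J := (('I_M * bool) + ('I_N * 'I_M * bool * bool))%type.
pose wt (j : J) : 'I_N -> R := match j with
  | inl (k, b) => sgn_wt b (@cos_wt R N 0)
  | inr (d, k, t, b) => sgn_wt b (if t then @cos_wt R N d else @sin_wt R N d)
  end.
pose ix (j : J) : 'I_M := match j with inl (k, _) => k | inr (_, k, _, _) => k end.
pose u (j : J) : R := if j is inl _ then uI else uB.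
pose g (j : J) (c : {ffun 'I_N -> 'I_M}) : R :=
  expR (cutoff M N (u j) / (N%:R * (M%:R - 1)) *
    (dev (wt j) (ix j) c - cutoff M N (u j))).
have g1 j c : cutoff M N (u j) <= dev (wt j) (ix j) c -> 1 <= g j c.
  move=> h; rewrite -expR0 ler_expR mulr_ge0 ?subr_ge0// divr_ge0 ?cutoff_ge0//.
  by rewrite mulr_ge0// subr_ge0 ler1n.
have wt1 j n : `|wt j n| <= 1.
  by case: j => [[k b]|[[[d k] []] b]]; apply: sgn_wt_le1; rewrite ?cos_max ?sin_max.
have sg j : \sum_c g j c <= (M ^ N)%:R * expR (- (Num.sqrt (u j) + u j)).
  apply: chernoff_cutoff => //.
    by case: j => ? /=; lra.
  by case: j.
apply: le_trans (prob_unif_ge (g := g) M0 _ _); last first.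
- move=> c /not_andP[hc|hc].
    have [k hk] : exists k, ~ `|dev (@cos_wt R N 0) k c| <= cutoff M N uI.
      by apply/existsNP => h; apply: hc; exact: mu_I_le.
    by have [b hb] := dev_gt_sgn hk; exists (inl (k, b)); exact: g1.
  have [d hd] : exists d : 'I_N, ~ forall k,
      `|dev (@cos_wt R N d) k c| <= cutoff M N uB /\
      `|dev (@sin_wt R N d) k c| <= cutoff M N uB.
    by apply/existsNP => h; apply: hc; exact: mu_B_le.
  have /existsNP [k /not_andP[hk|hk]] := hd.
    by have [b hb] := dev_gt_sgn hk; exists (inr (d, k, true, b)); exact: g1.
  by have [b hb] := dev_gt_sgn hk; exists (inr (d, k, false, b)); exact: g1.
- by move=> j c; exact: expR_ge0.
rewrite lerD2l lerN2 ler_pdivrMr//.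
apply: (le_trans (ler_sum _ (fun j _ => sg j))).
rewrite -mulr_sumr mulrC ler_pM2r// big_sumType/= /u /= !sumr_const.
have -> : #|{: 'I_M * bool}| = (2 * M)%N by rewrite card_prod card_ord card_bool mulnC.
have -> : #|{: 'I_N * 'I_M * bool * bool}| = (4 * (M * N))%N.
  by rewrite !card_prod !card_ord card_bool mulnC -!mulnA; lia.
rewrite !(opprD (Num.sqrt _)) !(expRD (- Num.sqrt _)) eI eB.
set a := expR (- Num.sqrt uI); set b := expR (- Num.sqrt uB).
have a2 : a <= 1 / 2.
  rewrite /a expRN -[1 / 2]mul1r mul1r div1r lef_pV2 ?posrE ?expR_gt0//.
  have : 1 <= Num.sqrt uI by rewrite -sqrtr1 ler_wsqrtr.
  by have := le1D (Num.sqrt uI); lra.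
have b8 : b <= 1 / 8.
  apply: (@le_trans _ _ (expR (- 1) ^+ 3)).
    by rewrite -expRM_natl ler_expR; lra.
  have : expR (- 1 : R) <= 1 / 2.
    by rewrite expRN div1r lef_pV2 ?posrE ?expR_gt0//; have := le1D 1; lra.
  have := expR_ge0 (- 1 : R); set y := expR _ => y0 y2.
  have -> : 1 / 8 = (1 / 2) ^+ 3 :> R by field.
  by rewrite lerXn2r ?nnegrE//; lra.
rewrite -[X in X + _]mulr_natl -[X in _ + X]mulr_natl.
have cancel (x y z : R) : 0 < x -> x * (y * (z / x)) = y * z.
  by move=> x0; field; rewrite gt_eqF.
rewrite cancel ?ltr0n ?muln_gt0// natrM -mulrA cancel ?ltr0n ?muln_gt0 ?M0//.
by nra.
Qed.

(** * Large N *)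

(** Since [exp u = M N / eps] dominates [u^7 / 7!], the bound [C u^6 <= N] holds once
    [u >= 7! C M / eps]. The threshold [B] adds 9 to that value, and [N >= exp B] forces
    [u >= B]. *)
Lemma log_pow6_eventually (R : realType) (M : nat) (eps C : R) :
  (2 <= M)%N -> 0 < eps -> eps < 1 -> 0 < C ->
  exists N0 : nat, forall N : nat, (N0 <= N)%N -> (0 < N)%N ->
  let u := ln ((M * N)%:R) - ln eps in
  9 <= u /\ C * u ^+ 6 <= N%:R.
Proof.
move=> hM e0 e1 C0.
pose B : R := 9 + 7`!%:R * C * (M%:R / eps).
exists (Num.truncn (expR B)).+1 => N hN N0 u.
have M0 : (0 < M)%N by apply: leq_trans hM.
have m0 : (0 : R) < M%:R by rewrite ltr0n.
have n0 : (0 : R) < N%:R by rewrite ltr0n.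
have hB : expR B <= N%:R.
  by rewrite ltW// (lt_le_trans (truncnS_gt _))// ler_nat.
have uE : expR u = M%:R * N%:R / eps.
  by rewrite expRB !lnK ?posrE ?ltr0n ?muln_gt0 ?M0// natrM.
have uB : B <= u.
  rewrite -ler_expR uE (le_trans hB)// mulrAC ler_peMl ?(ltW n0)//.
  by rewrite ler_pdivlMr// mul1r (le_trans (ltW e1))// ler1n.
have C1 : 0 <= 7`!%:R * C * (M%:R / eps) by rewrite !mulr_ge0 ?invr_ge0// ltW.
have u9 : 9 <= u by apply: le_trans uB; rewrite /B lerDl.
split=> //; have u0 : 0 <= u by lra.
have h := expR_ge1Dxn 6 u0; rewrite uE in h.
have h1 : u ^+ 7 / 7`!%:R <= M%:R * N%:R / eps by apply: le_trans h; rewrite lerDr.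
have f0 : (0 : R) < 7`!%:R by rewrite ltr0n fact_gt0.
have k0 : 0 < M%:R / eps by rewrite divr_gt0.
rewrite -(ler_pM2r k0) [leRHS]mulrA [N%:R * _]mulrC; apply: le_trans h1.
rewrite ler_pdivlMr//.
have -> : C * u ^+ 6 * (M%:R / eps) * 7`!%:R =
  u ^+ 6 * (7`!%:R * C * (M%:R / eps)) by ring.
rewrite [u ^+ 7]exprSr ler_wpM2l ?exprn_ge0//.
by apply: le_trans uB; rewrite /B lerDr.
Qed.

Lemma sqrt_ratio_le (R : realType) (M N : nat) (t : R) :
  (0 < M)%N -> (0 < N)%N -> 0 <= t -> M%:R <= t ^+ 2 * N%:R ->
  Num.sqrt ((M - 1)%:R / N%:R) <= t.
Proof.
move=> M0 N0 t0 h; have n0 : (0 : R) < N%:R by rewrite ltr0n.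
rewrite -[leRHS](ger0_norm t0) -sqrtr_sqr ler_wsqrtr// ler_pdivrMr//.
by apply: le_trans h; rewrite ler_nat leq_subr.
Qed.

(* [u >= 9] makes [1 + 2 sqrt u <= u]. *)
Lemma deltas_small (R : realType) (M N : nat) (eps : R) :
  (2 <= M)%N -> (2 <= N)%N -> 0 < eps -> eps < 1 ->
  let u := ln ((M * N)%:R) - ln eps in
  9 <= u -> 384 ^+ 2 * M%:R * u ^+ 6 <= N%:R ->
  [/\ M%:R * (1 + 2 * Num.sqrt (ln ((2 * M)%:R) - ln eps)) ^+ 6 <= N%:R,
      M%:R * (1 + 2 * Num.sqrt u) ^+ 6 <= N%:R,
      3 <= Num.sqrt u &
      delta1 M N eps + delta2 M N eps <= 1 / 8].
Proof.
move=> hM hN e0 e1 u u9 hu.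
have M0 : (0 < M)%N by apply: leq_trans hM.
have N0 : (0 < N)%N by apply: leq_trans hN.
have m0 : (0 : R) < M%:R by rewrite ltr0n.
have n0 : (0 : R) < N%:R by rewrite ltr0n.
have v3 : 3 <= Num.sqrt u.
  have -> : (3 : R) = Num.sqrt (3 ^+ 2) by rewrite sqrtr_sqr ger0_norm.
  by rewrite ler_wsqrtr//; lra.
have vv : Num.sqrt u ^+ 2 = u by rewrite sqr_sqrtr//; lra.
(* [2 <= N] gives [2 M <= M N], so both thresholds are controlled by [u]. *)
have uI : ln (2 * M)%:R - ln eps <= u.
  by rewrite lerD2r ler_ln ?posrE ?ltr0n ?muln_gt0 ?M0// ler_nat mulnC leq_mul.
set sI := 1 + 2 * Num.sqrt (ln ((2 * M)%:R) - ln eps).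
set sB := 1 + 2 * Num.sqrt u.
have sI1 : 1 <= sI by rewrite lerDl mulr_ge0// sqrtr_ge0.
have sIB : sI <= sB by rewrite lerD2l ler_wpM2l// ler_wsqrtr.
have sBu : sB <= u by rewrite /sB; nra.
have pow (s : R) : 1 <= s -> s <= u -> M%:R * s ^+ 6 <= N%:R.
  move=> s1 su; apply: le_trans hu.
  have : s ^+ 6 <= u ^+ 6 by rewrite lerXn2r ?nnegrE//; lra.
  have : 0 <= M%:R * u ^+ 6 by rewrite mulr_ge0 ?exprn_ge0//; lra.
  by nra.
have L0 : 0 <= ln ((M * N)%:R) :> R by rewrite ln_ge0// ler1n muln_gt0 M0.
have Lu : ln ((M * N)%:R) <= u by rewrite lerDl oppr_ge0 ln_le0// ltW.
set r := Num.sqrt ((M - 1)%:R / N%:R) : R.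
have r0 : 0 <= r by exact: sqrtr_ge0.
(* The constant is chosen so that [24 / 384 = 1/16], half of the allowed [1/8]; [delta2], with its
   factor [3/2], fits in the other half. *)
have ru : r * u ^+ 2 <= 1 / 384.
  have u2 : 0 < u ^+ 2 by rewrite exprn_gt0//; lra.
  rewrite -ler_pdivlMr//; apply: sqrt_ratio_le => //.
    by rewrite divr_ge0 ?(ltW u2)// divr_ge0.
  have -> : (1 / 384 / u ^+ 2) ^+ 2 * N%:R = N%:R / (384 ^+ 2 * u ^+ 4).
    by field; rewrite gt_eqF//; lra.
  have p0 : 0 < 384 ^+ 2 * u ^+ 4 by rewrite mulr_gt0 ?exprn_gt0//; lra.
  rewrite ler_pdivlMr//; apply: le_trans hu.
  have -> : M%:R * (384 ^+ 2 * u ^+ 4) = 384 ^+ 2 * M%:R * u ^+ 4 by ring.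
  apply: ler_wpM2l; first by rewrite mulr_ge0 ?exprn_ge0.
  by apply: ler_weXn2l => //; lra.
have d1 : delta1 M N eps <= 1 / 16.
  rewrite /delta1 -/r -/u [2 * _ + 1]addrC -/sB.
  apply: (@le_trans _ _ (24 * (r * u ^+ 2))); last by lra.
  have LsB : ln ((M * N)%:R) * sB <= u ^+ 2.
    by rewrite expr2 ler_pM// (le_trans _ sIB)// (le_trans _ sI1).
  by rewrite -!mulrA ler_pM2l// ler_wpM2l.
have d2 : delta2 M N eps <= 1 / 16.
  rewrite /delta2 -/r [2 * _ + 1]addrC -/sI.
  apply: (@le_trans _ _ (3 / 2 * (r * u ^+ 2))); last by lra.
  rewrite -[leLHS]mulrA ler_wpM2l ?divr_ge0// ler_wpM2l//.
  by rewrite (le_trans sIB)// (le_trans sBu)// expr2; nra.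
by split=> //; [apply: pow; lra | apply: pow; lra | lra].
Qed.

(** * Deterministic estimate: small coherences imply the good event *)

Lemma delta1E (R : realType) (M N : nat) (eps : R) :
  delta1 M N eps = 24 * coh_bound M N (ln ((M * N)%:R) - ln eps) * ln ((M * N)%:R).
Proof. by rewrite /delta1 /coh_bound; ring. Qed.

Lemma delta2E (R : realType) (M N : nat) (eps : R) :
  delta2 M N eps = 3 / 2 * coh_bound M N (ln ((2 * M)%:R) - ln eps).
Proof. by rewrite /delta2 /coh_bound; ring. Qed.

(** The hypothesis on [delta1 + delta2] gives [x >= 0], a sign that the square in [K_bound] forgets.
    The factor [1 + 2 delta2 / 3] of [K_bound] is exactly the available bound on [1 + mu_I]. *)
Lemma good_event_of_coh (R : realType) (M N K : nat) (eps : R)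
    (c : {ffun 'I_N -> 'I_M}) :
  (2 <= M)%N -> (0 < N)%N ->
  delta1 M N eps + delta2 M N eps <= 1 / 8 ->
  K%:R <= K_bound M N eps ->
  mu_I R c <= coh_bound M N (ln ((2 * M)%:R) - ln eps) ->
  mu_B R c <= coh_bound M N (ln ((M * N)%:R) - ln eps) ->
  good_event R K c.
Proof.
move=> hM N0 d12 hK hI hB.
have M0 : (0 < M)%N by apply: leq_trans hM.
have m2 : (2 : R) <= M%:R by rewrite ler_nat.
have n0 : (0 : R) < N%:R by rewrite ltr0n.
have k0 : (0 : R) <= K%:R by [].
rewrite /good_event; set s := specnorm _.
have s0 : 0 <= s by exact: specnorm_ge0.
have sM : s <= Num.sqrt M%:R by exact: specnorm_Psi_le.
have sM2 : s ^+ 2 <= M%:R.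
  by rewrite -[leRHS]sqr_sqrtr// lerXn2r ?nnegrE ?sqrtr_ge0.
have muI0 : 0 <= mu_I R c by apply: bigmax_ge_id.
(* From [exp (1/2) <= 2 <= M N]. *)
have L2 : 1 / 2 <= ln ((M * N)%:R) :> R.
  have h : (2 : R) <= (M * N)%:R by rewrite ler_nat (leq_trans hM)// leq_pmulr.
  have h2 := expR_ge1Dx (- (1 / 2) : R).
  have h3 : expR (1 / 2) <= 2 :> R.
    by rewrite -[1 / 2]opprK expRN invf_ple ?posrE ?expR_gt0//; lra.
  rewrite -ler_expR lnK ?posrE; first by apply: le_trans h.
  by apply: lt_le_trans h.
have d1 : 0 <= delta1 M N eps.
  have L0 : 0 <= ln ((M * N)%:R) :> R by apply: le_trans L2; rewrite divr_ge0.
  by rewrite delta1E mulr_ge0// mulr_ge0// coh_bound_ge0.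
have d2 : 0 <= delta2 M N eps by rewrite delta2E mulr_ge0 ?coh_bound_ge0// divr_ge0.
set x := 1 / 8 - delta1 M N eps - delta2 M N eps.
have x0 : 0 <= x by rewrite /x; lra.
have x8 : x <= 1 / 8 by rewrite /x; lra.
move: hK; rewrite /K_bound -/x => hK.
have h1 := delta1E M N eps; have h2 := delta2E M N eps.
set L := ln ((M * N)%:R) in L2 hK h1 hB *.
set D1 := delta1 M N eps in d1 x h1 x0 x8 hK *.
set D2 := delta2 M N eps in d2 x h2 x0 x8 hK *.
set muI := mu_I R c in hI muI0 *; set muB := mu_B R c in hB *.
have I2 : 3 * muI <= 2 * D2 by lra.
have B2 : 48 * muB * L <= 2 * D1.
  have : muB * L <= coh_bound M N (L - ln eps) * L by rewrite ler_wpM2r//; lra.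
  by lra.
have D0 : 0 < 81 * M%:R * L * (1 + 2 * D2 / 3).
  by rewrite !mulr_gt0//; lra.
have KM : K%:R * L * (1 + 2 * D2 / 3) / N%:R * M%:R <= (x / 9) ^+ 2.
  rewrite ler_pdivlMr// in hK.
  rewrite mulrAC ler_pdivrMr//.
  have -> : (x / 9) ^+ 2 * N%:R = N%:R * x ^+ 2 / 81 by field.
  rewrite ler_pdivlMr//; apply: le_trans hK.
  by rewrite le_eqVlt; apply/orP; left; apply/eqP; ring.
have T1 : Num.sqrt (K%:R * L * (1 + muI) / N%:R) * s <= x / 9.
  apply: (@le_trans _ _ (Num.sqrt (K%:R * L * (1 + muI) / N%:R) * Num.sqrt M%:R)).
    by rewrite ler_wpM2l ?sqrtr_ge0.
  have t0 : 0 <= K%:R * L * (1 + muI) / N%:R.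
    by rewrite divr_ge0 ?mulr_ge0//; lra.
  rewrite -sqrtrM// -[leRHS]ger0_norm; last by lra.
  rewrite -sqrtr_sqr ler_wsqrtr//; apply: le_trans KM.
  rewrite ler_wpM2r// ler_pM2r ?invr_gt0// ler_wpM2l ?mulr_ge0//; lra.
(* [KM] with [L >= 1/2] bounds this term by [4 (x / 9)^2], and [x <= 1/8] makes one factor [x / 9]
   at most [1/72]. *)
have T2 : 2 * K%:R / N%:R * s ^+ 2 <= x / 9.
  have e1 : K%:R / N%:R * s ^+ 2 <= K%:R / N%:R * M%:R.
    by rewrite ler_wpM2l// divr_ge0// ltW.
  have e2 : K%:R / N%:R * M%:R * (1 / 2) <= K%:R * L * (1 + 2 * D2 / 3) / N%:R * M%:R.
    have -> : K%:R * L * (1 + 2 * D2 / 3) / N%:R * M%:R =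
      K%:R / N%:R * M%:R * (L * (1 + 2 * D2 / 3)) by ring.
    have LD : 0 <= L * D2 by rewrite mulr_ge0//; lra.
    apply: ler_wpM2l; last by lra.
    by rewrite mulr_ge0// divr_ge0.
  have e3 : (x / 9) ^+ 2 <= x / 9 / 72 by nra.
  have -> : 2 * K%:R / N%:R * s ^+ 2 = 2 * (K%:R / N%:R * s ^+ 2) by ring.
  by lra.
rewrite -mulrA; set Q := Num.sqrt _ * s in T1 *.
have xE : x = 1 / 8 - D1 - D2 by [].
by lra.
Qed.

Lemma prob_unif_mono (R : realType) (M N : nat) (E E' : {ffun 'I_N -> 'I_M} -> Prop) :
  (forall c, E c -> E' c) -> prob_unif R E <= prob_unif R E'.
Proof.
move=> EE; rewrite /prob_unif ler_wpM2r ?invr_ge0// ler_nat subset_leq_card//.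
by apply/fintype.subsetP => c /asboolP/asboolP/EE h; apply/asboolP/asboolP.
Qed.

Theorem theorem3 (R : realType) (M : nat) (hM : (2 <= M)%N)
  (eps : R) (heps : 0 < eps) :
  exists N0 : nat, forall N : nat, (N0 <= N)%N -> (0 < N)%N ->
    forall K : nat, (0 < K)%N -> K%:R <= K_bound M N eps ->
      1 - eps <= @prob_unif R M N (@good_event R M N K).
Proof.
(* For [eps >= 1] the claimed probability is at most 0; the analysis below needs [ln eps < 0]. *)
have [e1|e1] := leP 1 eps.
  exists 0%N => N _ _ K _ _; rewrite (@le_trans _ _ 0) ?subr_le0//.
  by rewrite divr_ge0.
have m0 : (0 : R) < M%:R by rewrite ltr0n (leq_trans _ hM).
have C0 : (0 : R) < 384 ^+ 2 * M%:R by rewrite mulr_gt0// exprn_gt0.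
have [N0 hN0] := log_pow6_eventually hM heps e1 C0.
exists (maxn 2 N0) => N; rewrite geq_max => /andP[hN2 hN] N1 K _ hK.
have [u9 hu] := hN0 N hN N1.
have [hI hB v3 hd] := deltas_small hM hN2 heps e1 u9 hu.
apply: le_trans (mu_prob hM N1 heps e1 hI hB v3) _.
by apply: prob_unif_mono => c [muI muB]; exact: good_event_of_coh hK muI muB.
Qed.
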